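(* For any integer $n\ge 1$ there is a bijection $$\pi:\ \bigsqcup_{\substack{p+q=n-1\\ p\ge 0,\ q\ge 0}}\{1,\ldots,p+1\}\times Sh(p,q)\times PF_p\times PF_q\ \longrightarrow\ PF_n$$ given by $$\pi(a,\theta;f,g)=\bigl(a,\ \theta_*(f_1,\ldots,f_p,\ p+1+g_1,\ldots,p+1+g_q)\bigr).$$
   Context: A parking function of length $n$ is a sequence of integers $(i_1,\dots,i_n)$ whose nondecreasing rearrangement $j_1\le\cdots\le j_n$ satisfies $1\le j_k\le k$ for all $k$. $PF_n$ denotes the set of parking functions of length $n$; $PF_0$ consists of the empty sequence only. $Sh(p,q)$ is the set of $(p,q)$-shuffles, i.e. permutations written as words $\theta(1)\cdots\theta(p+q)$ in the letters $1,\dots,p+q$ in which $1,\dots,p$ appear in increasing order and $p+1,\dots,p+q$ appear in increasing order. For a sequence $(w_1,\dots,w_{p+q})$, $\theta_*(w_1,\dots,w_{p+q})=(w_{\theta(1)},\dots,w_{\theta(p+q)})$; that is, $\theta_*$ interleaves $(w_1,\dots,w_p)$ with $(w_{p+1},\dots,w_{p+q})$, keeping the order within each of the two blocks. In the formula $f=(f_1,\dots,f_p)$ and $g=(g_1,\dots,g_q)$, and $(a, u_1,\dots,u_{n-1})$ denotes the sequence $u$ with $a$ put in front. *)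

(* Defs.v *)
From mathcomp Require Import all_boot all_fingroup.

Set Implicit Arguments.
Unset Strict Implicit.
Unset Printing Implicit Defensive.

(* Entries are taken in nat rather than in the integers: the bound 1 <= j_k
   excludes negative entries anyway.  The k-th entry (k = 1, .., n) of the
   rearrangement has 0-based index k.-1, hence the bound k.+1 below. *)
Definition is_parking n (w : n.-tuple nat) : bool :=
  [forall k : 'I_n, 1 <= nth 0 (sort leq w) k <= k.+1].

Definition PF n : Type := {w : n.-tuple nat | is_parking w}.

(* Letters and positions are 0-based: the letter k of {1, .., p + q} is the
   ordinal of value k.-1.  A permutation s is read as the word
   s 0, s 1, .., s (p + q).-1, so that the letter i sits at position s^-1 i. *)
Definition is_shuffle p q (s : 'S_(p + q)) : bool :=
  [forall i : 'I_(p + q), forall j : 'I_(p + q),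
     (i < j) && ((j < p) || (p <= i)) ==> ((s^-1)%g i < (s^-1)%g j)].

Definition Sh p q : Type := {s : 'S_(p + q) | is_shuffle s}.

Definition shuffle_act (T : Type) m (s : 'S_m) (w : m.-tuple T) : m.-tuple T :=
  [tuple tnth w (s i) | i < m].

Definition splitting n : Type := {pq : nat * nat | pq.1 + pq.2 == n.-1}.

Definition pi_fiber (p q : nat) : Type :=
  ({a : nat | 1 <= a <= p.+1} * Sh p q * PF p * PF q)%type.

Definition pi_dom n : Type :=
  {pq : splitting n & pi_fiber (sval pq).1 (sval pq).2}.

(* Main.v *)
Require Import Defs.
From mathcomp Require Import all_boot all_fingroup zify.

(** A sequence of positive integers of length [n] is parking exactly when, for
    every [k <= n], at least [k] of its entries are at most [k].  Write [c(k)]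
    for the number of entries at most [k] in the tail [u] of a sequence
    [(a, u)].  If [(a, u)] comes from [(a, theta; f, g)], the entries at most
    [p] are those of [f], so [c(k) >= k] for [k <= p]; the entries of the
    shifted [g] exceed [p + 1], so [c(p + 1) = p].  Hence [p + 1] is the first
    [k] with [c(k) < k]: the tail alone determines [p] ([first_gap_uniq]),
    and the value [p + 1] never occurs in it.  The entry [a] is what fills
    this gap, which is why it may be anything up to [p + 1] ([parking_glue]).

    Conversely, if [(a, u)] is parking, then [c(k) < k] for some [k], since
    [c(n) <= n - 1 < n].  At the first such [k = p + 1], parking forces
    [a <= p + 1] ([parking_first_gap]) and [c(p) = c(p + 1) = p], so [u]
    splits into [p] entries at most [p] and [q] entries above [p + 1].  The
    counting criterion passes to both parts ([parking_cut]).

    The interleaving is recovered from the same threshold.  A shuffle is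
    determined by the set of positions holding letters of the first block, and
    every set of [p] positions arises ([shuffle_eq_mask], [shuffle_of_mask]).
    In a word of the image this set is the set of positions of entries at most
    [p].  Consequently the map is injective, and the construction above gives
    every parking function an explicit preimage. *)

(** * Parking functions by counting *)

Definition count_le (k : nat) (s : seq nat) : nat := count (fun x => x <= k) s.

Definition parking (s : seq nat) : Prop :=
  all (leq 1) s /\ forall k, k <= size s -> k <= count_le k s.

(** If the entry of index [k] in the sorted word is at most [k.+1], then so are
    the [k] entries before it, which yields [k.+1] small entries.  If instead it
    exceeds [k.+1], all later entries do too, and at most [k] small entries
    remain. *)
Lemma is_parkingP {n} (w : n.-tuple nat) : reflect (parking w) (is_parking w).
Proof.
set s := sort leq w.
have size_s : size s = n by rewrite size_sort size_tuple.
have count_s k : count_le k w = count_le k s.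
  by rewrite /count_le; apply/seq.permP; rewrite perm_sym; apply/permPl/perm_sort.
have all_s : all (leq 1) w = all (leq 1) s by rewrite all_sort.
have s_sorted : sorted leq s by apply: sort_sorted; apply: leq_total.
apply: (iffP forallP) => [nth_le | [w_pos w_count] k].
  split.
    rewrite all_s; apply/(all_nthP 0) => i; rewrite size_s => lt_in.
    by case/andP: (nth_le (Ordinal lt_in)).
  move=> k; rewrite size_tuple count_s => le_kn.
  have size_take_k : size (take k s) = k by rewrite size_takel ?size_s.
  have all_take : all (fun x => x <= k) (take k s).
    apply/(all_nthP 0) => i; rewrite size_take_k => lt_ik; rewrite nth_take //.
    have lt_in := leq_trans lt_ik le_kn.
    by case/andP: (nth_le (Ordinal lt_in)) => _ /leq_trans; apply.
  rewrite /count_le -(cat_take_drop k s) count_cat.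
  by move: all_take; rewrite all_count size_take_k => /eqP ->; rewrite leq_addr.
have lt_ks : k < size s by rewrite size_s.
rewrite -/s; apply/andP; split.
  by move: w_pos; rewrite all_s => /(all_nthP 0); apply.
rewrite leqNgt; apply/negP => gt_nth.
have := w_count k.+1; rewrite size_tuple count_s => /(_ (ltn_ord k)).
apply/negP; rewrite -ltnNge ltnS /count_le -(cat_take_drop k s) count_cat.
have /eqP -> : count (fun x => x <= k.+1) (drop k s) == 0.
  rewrite -leqn0 leqNgt -has_count; apply/negP => /(has_nthP 0) [i].
  rewrite size_drop nth_drop => lt_i le_nth.
  have := sorted_leq_nth leq_trans leqnn 0 s_sorted.
  move=> /(_ k (k + i)); rewrite !inE; lia.
by rewrite addn0 (leq_trans (count_size _ _)) // size_take_min geq_minl.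
Qed.

Lemma parking_le_size {s} : parking s -> all (fun x => x <= size s) s.
Proof.
case=> _ /(_ _ (leqnn _)) le_size.
by rewrite all_count eqn_leq count_size.
Qed.

Lemma perm_count_le {s t : seq nat} k : perm_eq s t -> count_le k s = count_le k t.
Proof. by move/seq.permP; apply. Qed.

Lemma count_le_cat k s t : count_le k (s ++ t) = count_le k s + count_le k t.
Proof. exact: count_cat. Qed.

Lemma count_le_shift k m s : count_le (m + k) [seq m + x | x <- s] = count_le k s.
Proof. by rewrite /count_le count_map; apply: eq_count => x /=; rewrite leq_add2l. Qed.

Lemma count_le_all {k p s} : all (fun x => x <= p) s -> p <= k -> count_le k s = size s.
Proof.
move=> /allP le_s le_pk; apply/eqP; rewrite -all_count; apply/allP => x /le_s le_xp.
exact: leq_trans le_pk.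
Qed.

Lemma count_le_none {k p s} : all (fun x => p < x) s -> k <= p -> count_le k s = 0.
Proof.
move=> /allP gt_s le_kp; apply/eqP; rewrite -leqn0 leqNgt -has_count.
by apply/hasPn => x /gt_s lt_px; rewrite -ltnNge (leq_ltn_trans le_kp).
Qed.

(** * The first gap of the tail *)

(** The number [p.+1] is the least [k] with [count_le k u < k].  Indexing by [p]
    instead of [p.+1] makes the parameter the length of the first block. *)
Definition first_gap (u : seq nat) (p : nat) : Prop :=
  (forall k, k <= p -> k <= count_le k u) /\ count_le p.+1 u <= p.

Lemma first_gap_uniq {u p p'} : first_gap u p -> first_gap u p' -> p = p'.
Proof.
move=> [le_u gap_p] [le_u' gap_p'].
by have := le_u p'.+1; have := le_u' p.+1; lia.
Qed.

(** A tail [u] has at most [size u] entries below [(size u).+1], so a gap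
    exists.  At the first one the whole word still satisfies the counting
    criterion, and only [a] can supply the missing entry. *)
Lemma parking_first_gap {a u} :
  parking (a :: u) -> {p | [/\ p <= size u, first_gap u p & a <= p.+1]}.
Proof.
case=> _ count_au.
have ex_gap : exists p, count_le p.+1 u <= p by exists (size u); apply: count_size.
case: (ex_minnP ex_gap) => p gap_p min_p; exists p.
have le_p : p <= size u by apply: min_p; apply: count_size.
split=> //.
  split=> // -[|k] // lt_kp.
  by rewrite ltnNge; apply/negP => /min_p; rewrite leqNgt lt_kp.
have := count_au p.+1 le_p; rewrite /count_le /= -/(count_le p.+1 u).
by case: (leqP a p.+1) => // _ /=; rewrite add0n ltnNge gap_p.
Qed.

Lemma perm_first_gap {u v : seq nat} {p} : perm_eq u v -> first_gap v p -> first_gap u p.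
Proof.
move=> uv [le_v gap]; split=> [k|]; last by rewrite (perm_count_le _ uv).
by rewrite (perm_count_le _ uv); apply: le_v.
Qed.

Lemma shift_gt p (g : seq nat) :
  all (leq 1) g -> all (fun x => p.+1 < x) [seq p + 1 + x | x <- g].
Proof. by move=> /allP g_pos; rewrite all_map; apply/allP => x /g_pos /=; lia. Qed.

Lemma first_gap_glue {f g} :
  parking f -> parking g ->
  first_gap (f ++ [seq size f + 1 + x | x <- g]) (size f).
Proof.
move=> pf [g_pos _]; have shift_g := shift_gt (size f) _ g_pos.
split=> [k le_k|]; rewrite count_le_cat.
  by apply: (leq_trans _ (leq_addr _ _)); case: pf => _; apply.
by rewrite (count_le_none shift_g) // addn0 count_size.
Qed.

(** Below the gap the entries of [f] suffice.  From the gap on, [a] and all of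
    [f] contribute [size f + 1] entries, which is exactly the shift of [g], so
    the criterion for [g] supplies the rest.  Only the multiset of entries
    matters, which makes the interleaving irrelevant. *)
Lemma parking_glue {a : nat} {f g u : seq nat} :
  1 <= a <= (size f).+1 -> parking f -> parking g ->
  perm_eq u (f ++ [seq size f + 1 + x | x <- g]) -> parking (a :: u).
Proof.
move=> /andP [a_pos le_a] pf pg u_perm.
have [f_pos f_count] := pf; have [g_pos g_count] := pg.
split.
  rewrite /= a_pos (perm_all _ u_perm) all_cat f_pos all_map.
  by apply/allP => x _ /=; lia.
have size_u : size u = size f + size g.
  by rewrite (perm_size u_perm) size_cat size_map.
move=> k; rewrite /= size_u => le_k.
rewrite /count_le /= -/(count_le k u) (perm_count_le _ u_perm) count_le_cat.
have [le_kf | lt_fk] := leqP k (size f).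
  by have := f_count k le_kf; lia.
rewrite (count_le_all (parking_le_size pf) (ltnW lt_fk)).
rewrite (leq_trans le_a lt_fk) /=.
have -> : k = (size f + 1) + (k - (size f + 1)) by lia.
have le_kg : k - (size f + 1) <= size g by lia.
by rewrite count_le_shift; have := g_count _ le_kg; lia.
Qed.

(** Up to [size f] the part [h] does not contribute to the counts, so [f]
    inherits them from [u].  The gap excludes the value [(size f).+1] from [h],
    so its entries can be lowered by [size f + 1] and stay positive; the
    counts of [a :: u] are then lowered by at most [size f + 1]. *)
Lemma parking_cut {a : nat} {u f h : seq nat} :
  parking (a :: u) -> first_gap u (size f) -> perm_eq u (f ++ h) ->
  all (fun x => x <= size f) f -> all (fun x => size f < x) h ->
  parking f /\ exists2 g, parking g & h = [seq size f + 1 + x | x <- g].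
Proof.
set p := size f => -[pos_au count_au] [count_u gap_u] u_perm f_le h_gt.
have /andP [f_pos h_pos] : all (leq 1) f && all (leq 1) h.
  by rewrite -all_cat -(perm_all _ u_perm); case/andP: pos_au.
have count_fh k : count_le k u = count_le k f + count_le k h.
  by rewrite (perm_count_le _ u_perm) count_le_cat.
split.
  split=> // k le_kp; have := count_u k le_kp.
  by rewrite count_fh (count_le_none h_gt le_kp) addn0.
have h_gt1 : all (fun x => p.+1 < x) h.
  have : count_le p.+1 h = 0.
    have := count_fh p.+1; rewrite (count_le_all f_le (leqnSn p)) -/p; lia.
  move/eqP; rewrite -leqn0 leqNgt -has_count => /hasPn none.
  by apply/allP => x /none; rewrite -ltnNge.
pose g := [seq x - (p + 1) | x <- h].
have h_def : h = [seq p + 1 + x | x <- g].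
  rewrite -map_comp -[LHS]map_id; apply/eq_in_map => x /(allP h_gt1) /=; lia.
exists g => //; split.
  by rewrite all_map; apply/allP => x /(allP h_gt1) /=; lia.
move=> k; rewrite size_map => le_k.
have size_u : size u = p + size h by rewrite (perm_size u_perm) size_cat.
have := count_au (p + 1 + k); rewrite /= size_u => /(_ ltac:(lia)).
rewrite /count_le /= -/(count_le (p + 1 + k) u) count_fh.
have le_pk : p <= p + 1 + k by lia.
rewrite (count_le_all f_le le_pk) h_def count_le_shift -/p.
by rewrite -/(count_le k g); case: (a <= _); lia.
Qed.

(** * Shuffles and their masks *)

Lemma is_shuffleP {p q} (s : 'S_(p + q)) :
  reflect (forall i j : 'I_(p + q), i < j -> (j < p) || (p <= i) ->
             (s^-1)%g i < (s^-1)%g j)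
          (is_shuffle s).
Proof.
apply: (iffP forallP) => [sh i j lt_ij blk | sh i].
  by move/forallP: (sh i) => /(_ j)/implyP; apply; rewrite lt_ij.
by apply/forallP => j; apply/implyP => /andP [lt_ij blk]; apply: sh.
Qed.

Lemma sorted_enum_filter {m} (P : pred 'I_m) :
  sorted (fun i j : 'I_m => i < j) [seq i <- enum 'I_m | P i].
Proof.
apply: sorted_filter => [i j k|]; first exact: ltn_trans.
have : sorted ltn [seq val i | i <- enum 'I_m] by rewrite val_enum_ord iota_ltn_sorted.
by rewrite sorted_map.
Qed.

(** Both maps enumerate their common image in increasing order. *)
Lemma increasing_on_inj {m} (A : pred 'I_m) (t t' : 'I_m -> 'I_m) :
  {in A &, {homo t : i j / i < j}} -> {in A &, {homo t' : i j / i < j}} ->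
  [seq t i | i in A] =i [seq t' i | i in A] -> {in A, t =1 t'}.
Proof.
move=> t_mono t'_mono same_im.
pose B := [seq i <- enum 'I_m | A i].
have memB : B =i enum A by move=> i; rewrite mem_filter !mem_enum andbT.
have B_sorted : sorted (fun i j : 'I_m => i < j) B := sorted_enum_filter _.
have allB : all A B by apply: filter_all.
suff tt' : map t B = map t' B.
  by move=> i Ai; move/eq_in_map: tt'; apply; rewrite mem_filter mem_enum andbT.
apply: (@irr_sorted_eq _ (fun i j : 'I_m => i < j)).
- by move=> i j k; apply: ltn_trans.
- by move=> i; apply: ltnn.
- by apply: (homo_sorted_in t_mono).
- by apply: (homo_sorted_in t'_mono).
- by move=> i; rewrite !(eq_mem_map _ memB); apply: same_im.
Qed.

(** The inverse of a shuffle sends letters to positions and increases on each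
    block, so it is determined by the sets of positions of the two blocks. *)
Lemma shuffle_eq_mask {p q} (s s' : 'S_(p + q)) :
  is_shuffle s -> is_shuffle s' ->
  (forall x, (s x < p) = (s' x < p)) -> s = s'.
Proof.
move=> /is_shuffleP sh /is_shuffleP sh' mask.
have im (A : pred nat) : (forall x, A (s x) = A (s' x)) ->
    [seq (s^-1)%g i | i in [pred i : 'I_(p + q) | A i]] =i
    [seq (s'^-1)%g i | i in [pred i : 'I_(p + q) | A i]].
  move=> AE x; apply/imageP/imageP => -[i Ai ->].
    by exists (s' ((s^-1)%g i)); rewrite ?permK // inE -AE permKV.
  by exists (s ((s'^-1)%g i)); rewrite ?permK // inE AE permKV.
apply: invg_inj; apply/permP => i.
have [lt_ip | le_pi] := ltnP i p.
  apply: (increasing_on_inj [pred i : 'I_(p + q) | i < p]) => //.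
  - by move=> j k _ ltk lt_jk; apply: sh => //; move: ltk; rewrite inE => ->.
  - by move=> j k _ ltk lt_jk; apply: sh' => //; move: ltk; rewrite inE => ->.
  - exact: (im (fun x => x < p)).
apply: (increasing_on_inj [pred i : 'I_(p + q) | p <= i]) => //.
- by move=> j k lej _ lt_jk; apply: sh => //; move: lej; rewrite inE orbC => ->.
- by move=> j k lej _ lt_jk; apply: sh' => //; move: lej; rewrite inE orbC => ->.
- have large x : (p <= s x) = (p <= s' x) by rewrite leqNgt mask -leqNgt.
  exact: (im (fun x => p <= x) large).
Qed.

(** The inverse of the shuffle is written down directly: as a word it lists the
    positions in [P] in increasing order, followed by the other positions in
    increasing order. *)
Lemma shuffle_of_mask {p q} (P : pred 'I_(p + q)) :
  count P (enum 'I_(p + q)) = p ->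
  {s : Sh p q | forall x, (sval s x < p) = P x}.
Proof.
move=> countP.
pose A := [seq i <- enum 'I_(p + q) | P i].
pose B := [seq i <- enum 'I_(p + q) | ~~ P i].
have sizeA : size A = p by rewrite size_filter.
have perm_AB : perm_eq (A ++ B) (enum 'I_(p + q)) by apply/permPl/perm_filterC.
have size_AB : size (A ++ B) = p + q by rewrite (perm_size perm_AB) size_enum_ord.
have sizeB : size B = q
  by move: size_AB; rewrite size_cat sizeA => /addnI.
(* The default [i] is never reached, as [i < size (A ++ B)]. *)
pose t (i : 'I_(p + q)) := nth i (A ++ B) i.
have t_inj : injective t.
  move=> i j /eqP.
  rewrite /t (set_nth_default j) ?size_AB // nth_uniq ?size_AB //.
    by move/eqP/val_inj.
  by rewrite (perm_uniq perm_AB) enum_uniq.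
have tP (i : 'I_(p + q)) : (i < p) = P (t i).
  rewrite /t nth_cat sizeA; case: ltnP => [lt_ip | le_pi].
    have : nth i A i \in A by apply: mem_nth; rewrite sizeA.
    by rewrite mem_filter => /andP [].
  have : nth i B (i - p) \in B.
    by apply: mem_nth; rewrite sizeB ltn_subLR.
  by rewrite mem_filter => /andP [/negbTE ->].
have lt_trans : transitive (fun i j : 'I_(p + q) => i < j).
  by move=> i j k; apply: ltn_trans.
have t_shuffle : is_shuffle (perm t_inj)^-1.
  apply/is_shuffleP => i j lt_ij; rewrite invgK !permE /t.
  have lt_j := ltn_ord j.
  rewrite (set_nth_default j i) ?size_AB // !nth_cat sizeA => /orP [lt_jp | le_pi].
    rewrite lt_jp (ltn_trans lt_ij lt_jp).
    by apply: (sorted_ltn_nth lt_trans) => //;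
      rewrite ?sorted_enum_filter // inE sizeA //; lia.
  rewrite !ltnNge le_pi (leq_trans le_pi (ltnW lt_ij)) /= -ltnNge.
  by apply: (sorted_ltn_nth lt_trans);
      rewrite ?sorted_enum_filter // ?inE ?sizeB; lia.
exists (exist _ (perm t_inj)^-1%g t_shuffle) => x /=.
by rewrite tP -[t _](permE t_inj) permKV.
Qed.

Lemma perm_shuffle_act {T : eqType} {m} (s : 'S_m) (w : m.-tuple T) :
  perm_eq (shuffle_act s w) w.
Proof. by apply/tuple_permP; exists s. Qed.

Lemma shuffle_act_permV {T : eqType} {m} (s : 'S_m) (w : m.-tuple T) :
  shuffle_act s (shuffle_act s^-1 w) = w.
Proof. by apply: eq_from_tnth => i; rewrite !tnth_mktuple permK. Qed.

Lemma tnth_cat_mask {p q} {T : Type} (P : pred T) (f : p.-tuple T) (h : q.-tuple T) i :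
  all P f -> all (predC P) h -> P (tnth [tuple of f ++ h] i) = (i < p).
Proof.
move=> /all_tnthP Pf /all_tnthP Ph.
case: (split_ordP i) => j ->.
  by rewrite tnth_lshift Pf.
by rewrite tnth_rshift; apply/negbTE/(Ph j).
Qed.

(** The predicate [P] marks in the interleaved word the positions that carry the
    first block, hence identifies the shuffle; undoing it gives the blocks. *)
Lemma shuffle_act_inj {p q} {T : eqType} (P : pred T)
    {f f' : p.-tuple T} {h h' : q.-tuple T} {s s' : 'S_(p + q)} :
  is_shuffle s -> is_shuffle s' ->
  all P f -> all P f' -> all (predC P) h -> all (predC P) h' ->
  shuffle_act s [tuple of f ++ h] = shuffle_act s' [tuple of f' ++ h'] ->
  [/\ s = s', f = f' & h = h'].
Proof.
move=> sh sh' Pf Pf' Ph Ph' eq_u.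
have eq_s : s = s'.
  apply: shuffle_eq_mask => // x.
  have := congr1 (fun u => P (tnth u x)) eq_u.
  by rewrite !tnth_mktuple !(tnth_cat_mask P).
subst s'.
have : val [tuple of f ++ h] = val [tuple of f' ++ h'].
  congr val; apply: eq_from_tnth => i.
  have := congr1 (fun u => tnth u ((s^-1)%g i)) eq_u.
  by rewrite !tnth_mktuple permKV.
move/eqP; rewrite /= eqseq_cat ?size_tuple // => /andP [/eqP ef /eqP eh].
by split=> //; apply: val_inj.
Qed.

(** The result is a sigma type, and not an existential, because it enters an
    inverse function. *)
Lemma unshuffle {p q} {T : eqType} (P : pred T) (u : (p + q).-tuple T) :
  count P u = p ->
  {x : Sh p q * p.-tuple T * q.-tuple T |
    [/\ all P x.1.2, all (predC P) x.2 &
        shuffle_act (sval x.1.1) [tuple of x.1.2 ++ x.2] = u]}.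
Proof.
move=> count_u.
have [|[s sh] /= sP] := shuffle_of_mask (fun i => P (tnth u i)).
  by rewrite -count_map map_tnth_enum.
pose w := shuffle_act s^-1 u.
have wP (i : 'I_(p + q)) : P (tnth w i) = (i < p).
  by rewrite tnth_mktuple -sP permKV.
pose f := [tuple tnth w (lshift q i) | i < p].
pose h := [tuple tnth w (rshift p i) | i < q].
exists (exist _ s sh, f, h); split.
- by apply/(@all_tnthP _ _ _ f) => i; rewrite tnth_mktuple wP /=.
- by apply/(@all_tnthP _ _ _ h) => i; rewrite /= tnth_mktuple wP /= -leqNgt leq_addr.
rewrite -[RHS](shuffle_act_permV s); congr shuffle_act.
apply: eq_from_tnth => i; case: (split_ordP i) => j ->.
  by rewrite tnth_lshift tnth_mktuple.
by rewrite tnth_rshift tnth_mktuple.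
Qed.

(** * The bijection *)

Definition pi_seq {p q} (x : pi_fiber p q) : seq nat :=
  let: (a, theta, f, g) := x in
  sval a :: shuffle_act (sval theta) [tuple of sval f ++ [seq p + 1 + x | x <- sval g]].

Lemma PF_parking {n} (f : PF n) : parking (sval f).
Proof. exact: (is_parkingP _ (svalP f)). Qed.

Lemma pi_tail_perm {p q} (s : 'S_(p + q)) (f : PF p) (g : PF q) :
  perm_eq (shuffle_act s [tuple of sval f ++ [seq p + 1 + x | x <- sval g]])
          (sval f ++ [seq size (sval f) + 1 + x | x <- sval g]).
Proof. by rewrite (perm_trans (perm_shuffle_act _ _)) //= size_tuple. Qed.

Lemma pi_seq_parking {p q} (x : pi_fiber p q) : parking (pi_seq x).
Proof.
case: x => [[[[a a_bnd] [s sh]] f] g] /=.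
apply: parking_glue (pi_tail_perm s f g); try exact: PF_parking.
by rewrite size_tuple.
Qed.

Lemma pi_seq_gap {p q} (x : pi_fiber p q) : first_gap (behead (pi_seq x)) p.
Proof.
case: x => [[[a [s sh]] f] g] /=.
apply: (perm_first_gap (pi_tail_perm s f g)).
rewrite -[X in first_gap _ X](size_tuple (sval f)).
by apply: first_gap_glue; apply: PF_parking.
Qed.

Lemma pi_seq_size {p q} (x : pi_fiber p q) : size (pi_seq x) = (p + q).+1.
Proof. by case: x => [[[a s] f] g]; exact: (congr1 S (size_tuple _)). Qed.

Lemma pi_seq_inj {p q} : injective (@pi_seq p q).
Proof.
move=> [[[[a a_bnd] [s sh]] f] g] [[[[a' a_bnd'] [s' sh']] f'] g'] eq_w.
have eq_a : a = a' := congr1 (head 0) eq_w.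
have eq_u : shuffle_act s [tuple of sval f ++ [tuple of [seq p + 1 + x | x <- sval g]]] =
            shuffle_act s' [tuple of sval f' ++ [tuple of [seq p + 1 + x | x <- sval g']]].
  by apply: val_inj; apply: (congr1 behead eq_w).
have small (f0 : PF p) : all (fun x => x <= p) (sval f0).
  by have := parking_le_size (PF_parking f0); rewrite size_tuple.
have large (g0 : PF q) :
    all (predC (fun x => x <= p)) [tuple of [seq p + 1 + x | x <- sval g0]].
  have [g_pos _] := PF_parking g0.
  apply: sub_all (shift_gt p _ g_pos) => x /=; lia.
have [eq_s eq_f eq_g] := shuffle_act_inj _ sh sh' (small f) (small f') (large g) (large g') eq_u.
have eq_gs : sval g = sval g'.
  by apply/val_inj/(inj_map (@addnI (p + 1)))/(congr1 val eq_g).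
subst a' s'.
by congr (_, _, _, _); apply: val_inj.
Qed.

(** Cutting the tail at its first gap gives the preimage.  Exactly [p] entries
    are at most [p]: at least [p] because the gap comes later, and at most [p]
    because no more than [p] are at most [p.+1]. *)
Lemma pi_seq_surj {n} (a : nat) (u : n.-tuple nat) :
  parking (a :: u) ->
  {pq : nat * nat & (pq.1 + pq.2 == n) & {x : pi_fiber pq.1 pq.2 | pi_seq x = a :: u}}.
Proof.
move=> park; have [p [le_p gap le_a]] := parking_first_gap park.
rewrite size_tuple in le_p.
have [q def_n] : {q | n = p + q} by exists (n - p); rewrite subnKC.
subst n; exists (p, q) => //=.
have count_p : count_le p u = p.
  apply/eqP; rewrite eqn_leq; case: gap => -> // gap; rewrite andbT.
  by apply: leq_trans gap; apply: sub_count => x /=; lia.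
have [[[[s sh] f] h] /= [f_le h_gt eq_u]] := unshuffle _ u count_p.
have perm_u : perm_eq u (f ++ h) by rewrite -eq_u; apply: perm_shuffle_act.
have h_gt' : all (fun x => p < x) h.
  by apply: sub_all h_gt => x /=; rewrite -ltnNge.
have [park_f ex_g] : parking f /\ exists2 g, parking g & tval h = [seq p + 1 + x | x <- g].
  by have := parking_cut park _ perm_u; rewrite size_tuple; apply.
pose g := map_tuple (subn^~ (p + 1)) h.
have [park_g def_h] : parking g /\ h = [tuple of [seq p + 1 + x | x <- g]].
  case: ex_g => g0 park_g0 def_h.
  have def_g : tval g = g0.
    by rewrite /= def_h -map_comp -[RHS]map_id; apply: eq_map => x /=; lia.
  by split; [rewrite def_g | apply: val_inj; rewrite /= -[map _ h]/(tval g) def_g].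
have a_bnd : 1 <= a <= p.+1 by rewrite le_a andbT; case: park => /andP [].
have [/is_parkingP f_PF /is_parkingP g_PF] := (park_f, park_g).
exists (exist _ a a_bnd, exist _ s sh, exist _ f f_PF, exist _ g g_PF) => /=.
by rewrite -[in RHS]eq_u; congr (_ :: tval (shuffle_act _ _)); rewrite [in RHS]def_h.
Qed.

Theorem theorem3p1 (n : nat) (hn : 1 <= n) :
  exists pi : pi_dom n -> PF n,
    bijective pi /\
    forall (p q : nat) (hpq : p + q == n.-1)
           (a : {a : nat | 1 <= a <= p.+1}) (theta : Sh p q)
           (f : PF p) (g : PF q),
      tval (sval (pi (existT (fun pq : splitting n =>
                                pi_fiber (sval pq).1 (sval pq).2)
                             (exist _ (p, q) hpq) (a, theta, f, g)))) =
      sval a :: shuffle_act (sval theta)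
                  [tuple of sval f ++ [seq p + 1 + x | x <- sval g]].
Proof.
(* Working with plain sequences avoids casting between tuples of lengths
   [(p + q).+1] and [n]; the length is attached only here. *)
have pi_size (x : pi_dom n) : size (pi_seq (projT2 x)) == n.
  by rewrite pi_seq_size (eqP (valP (projT1 x))) prednK.
have pi_park (x : pi_dom n) : is_parking (Tuple (pi_size x)).
  exact/is_parkingP/pi_seq_parking.
pose pi (x : pi_dom n) : PF n := exist _ (Tuple (pi_size x)) (pi_park x).
have pi_inj : injective pi.
  move=> [[[p q] hpq] x] [[[p' q'] hpq'] x'] /(congr1 (fun w : PF n => tval (sval w))).
  rewrite /= => eq_w.
  have eq_p : p = p'.
    by apply: first_gap_uniq (pi_seq_gap x) _; rewrite eq_w; apply: pi_seq_gap.
  subst p'.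
  have eq_q : q = q' := addnI (etrans (eqP hpq) (esym (eqP hpq'))).
  subst q'.
  have eq_hpq := eq_irrelevance hpq hpq'; subst hpq'.
  by rewrite (pi_seq_inj _ _ eq_w).
(* A right inverse of an injection is a two-sided inverse. *)
have pi_surj (w : PF n) : {x | pi x = w}.
  case: n hn pi_size pi_park @pi pi_inj w => // n _ pi_size pi_park pi _ [w w_PF].
  have := is_parkingP _ w_PF.
  case/tupleP: w w_PF => a u w_PF /= /pi_seq_surj [pq hpq [x eq_x]].
  exists (existT _ (exist _ pq hpq) x).
  by apply/val_inj/val_inj.
exists pi; split=> //.
exists (fun w => sval (pi_surj w)) => [x | w]; last exact: svalP (pi_surj w).
by apply: pi_inj; apply: svalP (pi_surj (pi x)).
Qed.
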